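(* Let $n \ge 3$ and $k$ be integers with $0 \le k \le n-3$. Define the sequence $P_{\min_{n,k}} = \{p_1, p_2, \ldots, p_n\}$ by $p_1 = 1$; $p_i = F(i-1)$ for $2 \le i \le k+2$; $p_{k+3} = F(k+2) = w_{F(k+2),0}$; and $p_i = w_{F(k+2),\, i-k-3}$ for $k+4 \le i \le n$. Then $P_{\min_{n,k}}$ is a minimizing $k$-ordered sequence of the elongated binary tree in the class $M_{n,k}$; that is, $P_{\min_{n,k}} \in M_{n,k}$ and the Huffman cost (weighted external path length of its elongated Huffman tree) of $P_{\min_{n,k}}$ is at most that of every sequence in $M_{n,k}$.
   Context: $F(i)$ denotes the $i$-th Fibonacci number: $F(0)=0$, $F(1)=1$, $F(i)=F(i-1)+F(i-2)$ for $i>1$. Let $\varphi=(1+\sqrt5)/2$. The (generalized) Wythoff array $(w_{i,j})_{i\ge 0, j\ge 0}$ is defined by $w_{i,0}=i$, $w_{i,1}=\lfloor (i+1)\varphi\rfloor$, and $w_{i,j}=w_{i,j-1}+w_{i,j-2}$ for $j\ge 2$. A (strictly) binary tree is an ordered rooted tree in which every non-leaf node has exactly two children; its size is its number of leaves. A binary tree is elongated if among any two sibling nodes at least one is a leaf. For a binary tree $T$ with positive weights $p_1,\dots,p_n$ at its leaves, the weighted external path length is $E(T,P)=\sum_{i=1}^n l_i p_i$, where $l_i$ is the length of the path from the root to leaf $i$. Huffman algorithm on a non-decreasing sequence $P=\{p_1,\dots,p_n\}$ of positive integers: set $P^{(0)}=P$; for $i=1,\dots,n-1$, the sequence $P^{(i)}=\{p^{(i)}_1,\dots,p^{(i)}_{n-i}\}$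 is obtained from $P^{(i-1)}$ by replacing its two first (smallest) entries $p^{(i-1)}_1,p^{(i-1)}_2$ by their sum and sorting the result in non-decreasing order; the merges define a binary tree (a Huffman tree of $P$), which minimizes $E(T,P)$ over all binary trees with leaf weights $P$; this minimum is the Huffman cost. A non-decreasing sequence $P$ of $n$ positive integers is $k$-ordered if $p^{(i)}_2 = p^{(i)}_3$ for $i=0,\dots,k$ and $p^{(i)}_2 < p^{(i)}_3$ for $i=k+1,\dots,n-3$. $M_{n,k}$ denotes the set of all $k$-ordered sequences of size $n$ for which an elongated binary tree of size $n$ is a Huffman tree. A sequence $P_{\min}\in M$ is minimizing for the tree $T$ in a class $M$ if $E(T,P_{\min})\le E(T,P)$ for all $P\in M$. *)

(* Defs.v *)
From HB Require Import structures.
From mathcomp Require Import all_boot all_order all_algebra.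

Set Implicit Arguments.
Unset Strict Implicit.
Unset Printing Implicit Defensive.

Import Order.TTheory GRing.Theory Num.Theory.

Fixpoint fib (i : nat) : nat :=
  match i with
  | 0 => 0
  | i1.+1 => if i1 is i2.+1 then fib i1 + fib i2 else 1
  end.

Definition golden (R : archiRcfType) : R := ((1 + Num.sqrt 5) / 2)%R.

(* Num.truncn is the floor, as a natural number, of a nonnegative real. *)
Fixpoint wythoff (R : archiRcfType) (i j : nat) : nat :=
  match j with
  | 0 => i
  | j1.+1 =>
      if j1 is j2.+1 then wythoff R i j1 + wythoff R i j2
      else Num.truncn (i.+1%:R * golden R)%R
  end.

(* Strictly binary ordered trees carrying a weight at each leaf. *)
Inductive wtree : Type :=
  | Leaf of nat
  | Node of wtree & wtree.

Fixpoint wtree_encode (t : wtree) : GenTree.tree nat :=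
  match t with
  | Leaf p => GenTree.Leaf p
  | Node l r => GenTree.Node 0 [:: wtree_encode l; wtree_encode r]
  end.

Fixpoint wtree_decode (u : GenTree.tree nat) : option wtree :=
  match u with
  | GenTree.Leaf p => Some (Leaf p)
  | GenTree.Node _ [:: u1; u2] =>
      if wtree_decode u1 is Some l then
        if wtree_decode u2 is Some r then Some (Node l r) else None
      else None
  | _ => None
  end.

Lemma wtree_encodeK : pcancel wtree_encode wtree_decode.
Proof. by elim=> [p|l IHl r IHr] //=; rewrite IHl IHr. Qed.

HB.instance Definition _ := Countable.copy wtree (pcan_type wtree_encodeK).

Definition is_leaf (t : wtree) : bool := if t is Leaf _ then true else false.

Fixpoint weight (t : wtree) : nat :=
  match t with
  | Leaf p => p
  | Node l r => weight l + weight r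
  end.

Fixpoint elongated (t : wtree) : bool :=
  match t with
  | Leaf _ => true
  | Node l r => [&& is_leaf l || is_leaf r, elongated l & elongated r]
  end.

(* Contribution of the leaves of t when the root of t sits at depth d. *)
Fixpoint path_length_at (d : nat) (t : wtree) : nat :=
  match t with
  | Leaf p => d * p
  | Node l r => path_length_at d.+1 l + path_length_at d.+1 r
  end.

Definition ext_path_length (t : wtree) : nat := path_length_at 0 t.

(* On sequences the algorithm is deterministic; iter i huffman_step P is the
   sequence obtained from the non-decreasing sequence P after i merges. *)
Definition huffman_step (s : seq nat) : seq nat :=
  if s is p1 :: p2 :: s' then sort leq (p1 + p2 :: s') else s.

(* On trees ties may be broken in any way, and either of the two merged trees
   may become the left child, so a sequence may have several Huffman trees. *)
Inductive huffman_from : seq wtree -> wtree -> Prop :=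
  | HuffmanDone (t : wtree) : huffman_from [:: t] t
  | HuffmanMerge (f r : seq wtree) (t1 t2 t : wtree) :
      perm_eq f [:: t1, t2 & r] ->
      all (fun u => (weight t1 <= weight u) && (weight t2 <= weight u)) r ->
      huffman_from (Node t1 t2 :: r) t ->
      huffman_from f t.

Definition huffman_tree (P : seq nat) (t : wtree) : Prop :=
  huffman_from (map Leaf P) t.

(* The j-th entry (counted from 1) of a sequence s is nth 0 s (j - 1). *)
Definition k_ordered (n k : nat) (P : seq nat) : Prop :=
  [/\ size P = n,
      sorted leq P,
      all (fun p => 0 < p) P,
      forall i, i <= k ->
        nth 0 (iter i huffman_step P) 1 = nth 0 (iter i huffman_step P) 2
    & forall i, k < i <= n - 3 ->
        nth 0 (iter i huffman_step P) 1 < nth 0 (iter i huffman_step P) 2].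

(* The class M_{n,k}. *)
Definition elongated_k_ordered (n k : nat) (P : seq nat) : Prop :=
  k_ordered n k P /\ exists2 t, huffman_tree P t & elongated t.

(* Elongated shapes of a given size differ only by swapping siblings, so the
   elongated Huffman trees of P and Q need not be the same ordered tree. *)
Definition minimizing_elongated (M : seq nat -> Prop) (P : seq nat) : Prop :=
  M P /\
  forall (Q : seq nat) (t u : wtree), M Q ->
    huffman_tree P t -> elongated t ->
    huffman_tree Q u -> elongated u ->
    ext_path_length t <= ext_path_length u.

Definition Pmin_entry (R : archiRcfType) (k i : nat) : nat :=
  if i == 1 then 1
  else if i <= k + 2 then fib (i - 1)
  else wythoff R (fib (k + 2)) (i - k - 3).

Definition Pmin (R : archiRcfType) (n k : nat) : seq nat :=
  [seq Pmin_entry R k i | i <- iota 1 n].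

(* Main.v *)
(* Write S_i = p_1 + ... + p_i. An elongated Huffman tree merges, at every step
   after the first, the unique internal tree of the forest with the smallest
   remaining leaf; this is legal exactly when S_i <= p_(i+2) for all i, the cost
   is then S_2 + ... + S_n, and the second and third entries of P^(i) are
   max (S_(i+1), p_(i+2)) and p_(i+3). Hence membership in M_(n,k) amounts to
   p_(i+3) = max (S_(i+1), p_(i+2)) for i <= k and > for i > k. The sequence
   starting with 1, 1 in which each strict inequality is tight, that is, off by
   one, is entrywise minimal, so its cost is minimal too; it is P_min because
   floor ((F(m) + 1) phi) = F(m+1) + 1 for m >= 2. *)
Require Import Defs.
From mathcomp Require Import all_boot all_order all_algebra.
From mathcomp Require Import zify ring lra.

Set Implicit Arguments.
Unset Strict Implicit.
Unset Printing Implicit Defensive.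

(** * Fibonacci numbers and the golden ratio *)

Lemma fibSS i : fib i.+2 = fib i.+1 + fib i.
Proof. by []. Qed.

Lemma fib_gt0 i : 0 < fib i.+1.
Proof. by elim: i => // i IHi; rewrite fibSS ltn_addr. Qed.

Section Golden.

Import Order.TTheory GRing.Theory Num.Theory.
Local Open Scope ring_scope.
Implicit Type R : archiRcfType.

Lemma golden_sqr R : golden R * golden R = golden R + 1.
Proof.
have h5 : Num.sqrt 5 * Num.sqrt 5 = 5 :> R by rewrite -expr2 sqr_sqrtr ?ler0n.
by rewrite /golden; field: h5.
Qed.

Lemma golden_bounds R : 3 / 2 <= golden R < 2.
Proof.
have h0 : 0 <= Num.sqrt 5 :> R by rewrite sqrtr_ge0.
have h5 : Num.sqrt 5 * Num.sqrt 5 = 5 :> R by rewrite -expr2 sqr_sqrtr ?ler0n.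
by rewrite /golden; apply/andP; split; nra.
Qed.

(* With d_m = F(m) phi - F(m+1) one has d_(m+1) = - (phi - 1) d_m, and this
   interval, which contains d_2 = phi - 2, is mapped into itself. *)
Lemma fib_golden_error R m : (2 <= m)%N ->
  golden R - 2 <= (fib m)%:R * golden R - (fib m.+1)%:R
    <= (golden R - 1) * (2 - golden R).
Proof.
have sq := golden_sqr R; have /andP[lo hi] := golden_bounds R.
elim: m => // -[//|[_ _|m IHm _]].
  by rewrite /= addn0 -[(1 + 1)%N]/2%N; apply/andP; split; nra.
have {IHm} := IHm isT; rewrite (fibSS m.+2) natrD.
set a : R := (fib m.+2)%:R; set b : R := (fib m.+3)%:R => /andP[h1 h2].
have -> : b * golden R - (b + a) = - (golden R - 1) * (a * golden R - b).
  by ring: sq.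
move: (a * golden R - b) h1 h2 => d h1 h2.
by apply/andP; split; nra.
Qed.

(** Adding phi to F(m) phi - F(m+1), whose bounds are known, gives a number between 2 phi - 2 and 3
    phi - 3, hence in [1, 2). *)
Lemma truncn_fib_golden R m : (2 <= m)%N ->
  Num.truncn ((fib m).+1%:R * golden R) = (fib m.+1).+1.
Proof.
move=> /(fib_golden_error R)/andP[h1 h2].
have sq := golden_sqr R; have /andP[lo hi] := golden_bounds R.
apply: truncn_def; rewrite -!natr1.
by apply/andP; split; nra.
Qed.

End Golden.

(** * Huffman merges on sorted sequences of weights *)

Section Sequences.
Implicit Types (P Q s : seq nat) (w x y i m : nat).

Definition prefix_sum s m := \sum_(j < m) nth 0 s j.

Lemma prefix_sum0 s : prefix_sum s 0 = 0.
Proof. exact: big_ord0. Qed.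

Lemma prefix_sum_cons x s m : prefix_sum (x :: s) m.+1 = x + prefix_sum s m.
Proof. exact: big_ord_recl. Qed.

(* A tree of weight w can successively be merged with the entries of s, each
   merge being legal for the Huffman algorithm. *)
Definition absorbs w s :=
  forall i, i.+1 < size s -> w + prefix_sum s i <= nth 0 s i.+1.

(** An external path length is the sum of the weights of the internal nodes; these are the nodes
    created by the merges with [s]. *)
Definition absorb_cost w s := \sum_(i < size s) (w + prefix_sum s i.+1).

(** The instance [i = 0] compares [w] only with the entry after [x]; sortedness extends it to all of
    [s]. The other instances are those for [w + x]. *)
Lemma absorbs_cons w x s : sorted leq (x :: s) ->
  absorbs w (x :: s) <-> all (leq w) s /\ absorbs (w + x) s.
Proof.
move=> srt; split=> [h|[h1 h2]].
  split.
    case: s srt h => // y s /= /andP[_ /(order_path_min leq_trans) ys] h.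
    have := h 0 isT; rewrite prefix_sum0 addn0 /= => wy; rewrite wy /=.
    by apply: sub_all ys => z; apply: leq_trans.
  by move=> i hi; rewrite -addnA -prefix_sum_cons; apply: h.
case=> [|i] /= hi; last by rewrite prefix_sum_cons addnA; apply: h2.
by rewrite prefix_sum0 addn0; apply: (all_nthP 0 h1).
Qed.

Lemma absorb_cost_cons w x s :
  absorb_cost w (x :: s) = w + x + absorb_cost (w + x) s.
Proof.
rewrite /absorb_cost big_ord_recl prefix_sum_cons prefix_sum0 addn0.
congr (_ + _); apply: eq_bigr => i _.
by rewrite /= prefix_sum_cons addnA.
Qed.

Lemma perm_sorted_head x y (r : seq nat) s : sorted leq (y :: s) ->
  perm_eq (x :: r) (y :: s) -> all (leq x) r -> x = y /\ perm_eq r s.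
Proof.
move=> /= /(order_path_min leq_trans) ys xrys xr.
have xy : x = y.
  apply/eqP; rewrite eqn_leq.
  have : y \in x :: r by rewrite (perm_mem xrys) mem_head.
  have : x \in y :: s by rewrite -(perm_mem xrys) mem_head.
  rewrite !inE => /orP[/eqP ->|/(allP ys) ->]; first by rewrite leqnn.
  by case/orP=> [/eqP ->|/(allP xr) ->]; rewrite ?leqnn.
by split=> //; move: xrys; rewrite xy perm_cons.
Qed.

Lemma sort_cons2 w x s : sorted leq (x :: s) -> all (leq w) s ->
  sort leq [:: w, x & s] = [:: minn w x, maxn w x & s].
Proof.
move=> srt ws; have xs := order_path_min leq_trans srt.
have perm2 : perm_eq [:: w, x & s] [:: minn w x, maxn w x & s].
  case: (leqP w x) => // _.
  exact: (permEl (perm_catCA [:: w] [:: x] s)).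
have srt2 : sorted leq [:: minn w x, maxn w x & s].
  rewrite /= geq_min leq_max leqnn /=.
  rewrite path_min_sorted ?(path_sorted srt) //.
  apply/allP=> z zs; rewrite geq_max.
  by rewrite (allP ws) ?(allP xs).
have /(perm_sortP leq_total leq_trans anti_leq) -> := perm2.
exact: sorted_sort leq_trans _ srt2.
Qed.

(** Each merge joins the accumulated weight to the next entry. The [sort] remains because that
    weight may lie on either side of the first unmerged entry. *)
Lemma iter_huffman_step i w s : sorted leq s -> absorbs w s -> i <= size s ->
  iter i huffman_step (sort leq (w :: s)) =
  sort leq (w + prefix_sum s i :: drop i s).
Proof.
elim: i w s => [|i IHi] w s; first by rewrite prefix_sum0 addn0 drop0.
case: s => // x s srt /(absorbs_cons _ srt)[ws wxs] his.
rewrite iterSr sort_cons2 //= addn_min_max IHi ?(path_sorted srt) //.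
by rewrite prefix_sum_cons addnA.
Qed.

Lemma absorbs_drop i w s : sorted leq s -> absorbs w s -> i <= size s ->
  absorbs (w + prefix_sum s i) (drop i s).
Proof.
elim: i w s => [|i IHi] w s; first by rewrite prefix_sum0 addn0 drop0.
case: s => // x s srt /(absorbs_cons _ srt)[_ wxs] his.
by rewrite prefix_sum_cons addnA; apply: IHi; rewrite ?(path_sorted srt).
Qed.

Lemma nth_iter_huffman_step i w s : sorted leq (w :: s) -> absorbs w s ->
    i < size s ->
  nth 0 (iter i huffman_step (w :: s)) 1 =
    maxn (prefix_sum (w :: s) i.+1) (nth 0 (w :: s) i.+1) /\
  nth 0 (iter i huffman_step (w :: s)) 2 = nth 0 (w :: s) i.+2.
Proof.
move=> srt ws his; have ssrt := path_sorted srt.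
rewrite -[X in iter _ _ X](sorted_sort leq_trans srt).
rewrite iter_huffman_step ?(ltnW his) // prefix_sum_cons.
have := absorbs_drop ssrt ws (ltnW his).
have := drop_sorted i ssrt; rewrite (drop_nth 0 his) => dsrt.
move=> /(absorbs_cons _ dsrt)[mins _].
by rewrite sort_cons2 //= nth_drop addn0.
Qed.

(** Ties leave open which two trees are merged, but neither their total weight nor the multiset of
    the remaining weights. *)
Lemma perm_sorted_head2 x y (r : seq nat) p q s : sorted leq [:: p, q & s] ->
    perm_eq [:: x, y & r] [:: p, q & s] ->
    all (fun z => (x <= z) && (y <= z)) r ->
  x + y = p + q /\ perm_eq r s.
Proof.
wlog xy : x y / x <= y => [IH srt xyr|srt xyr].
  case/orP: (leq_total x y) => [/IH|yx /=]; first exact.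
  rewrite (@eq_all _ _ (fun z => (y <= z) && (x <= z))); last first.
    by move=> z; rewrite andbC.
  rewrite addnC; apply: IH => //.
  by rewrite -(permPl (permEl (perm_catCA [:: x] [:: y] r))).
rewrite all_predI => /andP[xr yr].
have [|xp yrs] := perm_sorted_head srt xyr; first by rewrite /= xy.
by have [-> ->] := perm_sorted_head (path_sorted srt) yrs yr; rewrite xp.
Qed.

End Sequences.

(** * Elongated Huffman trees *)

Section Trees.
Implicit Types (t u a : wtree) (f r : seq wtree) (s z : seq nat).

Lemma path_length_atE d t :
  path_length_at d t = d * weight t + ext_path_length t.
Proof.
rewrite /ext_path_length; elim: t d => [p|l IHl r IHr] d /=; first by lia.
by rewrite !(IHl d.+1, IHr d.+1) (IHl 1) (IHr 1); lia.
Qed.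

Lemma ext_path_length_node t u : ext_path_length (Node t u) =
  weight t + weight u + (ext_path_length t + ext_path_length u).
Proof.
by rewrite /ext_path_length /= !(path_length_atE 1) /ext_path_length; lia.
Qed.

Lemma all_leaf_map f : all is_leaf f -> f = map Leaf (map weight f).
Proof. by elim: f => // -[] //= p f IHf /IHf <-. Qed.

(* Two internal trees in the forest would end up as, or inside, siblings. *)
Lemma elongated_forest f t : huffman_from f t -> elongated t ->
  all elongated f && (count (predC is_leaf) f <= 1).
Proof.
elim=> {f t} [t|f r t1 t2 t ff _ _ IH] /=.
  by move=> -> /=; case: t.
move=> /IH /= /andP[/andP[/and3P[l12 e1 e2] er] cr].
rewrite (perm_all _ ff) (permP ff) /= e1 e2 er /=.
by case/orP: l12 => ->; move: cr; case: (is_leaf _) => /=; lia.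
Qed.

Lemma perm_leaf_head u r s : sorted leq s -> perm_eq (u :: r) (map Leaf s) ->
    all (fun v => weight u <= weight v) r ->
  exists x s', [/\ s = x :: s', u = Leaf x & perm_eq r (map Leaf s')].
Proof.
move=> srt urs ur.
have : u \in map Leaf s by rewrite -(perm_mem urs) mem_head.
case/mapP=> x _ uE; rewrite {}uE in urs ur *.
have : perm_eq (x :: map weight r) s.
  by have := perm_map weight urs; rewrite -map_comp map_id.
case: s srt urs => [|y s] srt urs pw; first by have := perm_size pw.
have [xy _] : x = y /\ perm_eq (map weight r) s.
  by apply: perm_sorted_head pw _ => //; rewrite all_map.
exists x, s; split=> //; first by rewrite xy.
by move: urs; rewrite /= -xy perm_cons.
Qed.

(** The node made by a merge is the only internal tree that an elongated result allows, so every
    merge must involve the current internal tree [a]. Generality in [a] and [s] lets the induction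
    follow the run. *)
Lemma huffman_absorb f t : huffman_from f t -> elongated t ->
  forall a s, ~~ is_leaf a -> sorted leq s -> perm_eq f (a :: map Leaf s) ->
  absorbs (weight a) s /\
  ext_path_length t = ext_path_length a + absorb_cost (weight a) s.
Proof.
elim=> {f t} [t|f r t1 t2 t ff min12 hr IH] et a s al srt fs.
  have := perm_size fs; case: s srt fs => //= _ tt _.
  have -> : t = a by have := perm_mem tt t; rewrite !inE eqxx => /esym/eqP.
  by rewrite /absorb_cost big_ord0 addn0; split=> // i.
have /andP[/= _ cr] := elongated_forest hr et.
have rl : all is_leaf r.
  by move: cr; rewrite all_count; have := count_predC is_leaf r; lia.
(* The partner [u] of [a] is a smallest leaf. Both positions of [a] among [t1] and [t2] reduce to
   this claim. *)
have merge_step u : perm_eq [:: a, u & r] (a :: map Leaf s) ->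
    all (fun v => (weight a <= weight v) && (weight u <= weight v)) r ->
    weight (Node t1 t2) = weight a + weight u ->
    ext_path_length (Node t1 t2) =
      weight a + weight u + (ext_path_length a + ext_path_length u) ->
  absorbs (weight a) s /\
  ext_path_length t = ext_path_length a + absorb_cost (weight a) s.
  rewrite perm_cons all_predI => us /andP[ar ur] wE lE.
  have [x [s' [sE uE rs']]] := perm_leaf_head srt us ur.
  rewrite sE in srt *; have := IH et (Node t1 t2) s' isT (path_sorted srt).
  rewrite perm_cons rs' wE lE uE => /(_ isT)[absb ->].
  rewrite absorbs_cons // absorb_cost_cons; split; last first.
    by rewrite {2}/ext_path_length /=; lia.
  split=> //; have : all (leq (weight a)) (map weight r) by rewrite all_map.
  by rewrite (perm_all _ (perm_map weight rs')) -map_comp map_id.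
have {fs} fs : perm_eq [:: t1, t2 & r] (a :: map Leaf s).
  by rewrite -(permPl ff).
have : a \in [:: t1, t2 & r] by rewrite (perm_mem fs) mem_head.
rewrite !inE => /or3P[/eqP aE|/eqP aE|/(allP rl)]; last by rewrite (negPf al).
  move: fs min12 merge_step; rewrite -aE => fs min12 merge_step.
  by apply: (merge_step t2) => //; rewrite ext_path_length_node.
move: fs min12 merge_step; rewrite -aE => fs min12 merge_step.
apply: (merge_step t1) => //.
- by rewrite -(permPr fs) (permEl (perm_catCA [:: a] [:: t1] r)).
- by apply: sub_all min12 => v; rewrite andbC.
- exact: addnC.
- by rewrite ext_path_length_node; lia.
Qed.

Lemma huffman_absorb_exists a s : elongated a -> sorted leq s ->
  absorbs (weight a) s ->
  exists2 t, huffman_from (a :: map Leaf s) t & elongated t.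
Proof.
elim: s a => [|x s IHs] a ea srt; first by exists a => //; constructor.
move=> /(absorbs_cons _ srt)[aS axS].
have xs := order_path_min leq_trans srt.
have [|t ht et] := IHs (Node a (Leaf x)) _ (path_sorted srt) axS.
  by rewrite /= orbT ea.
exists t => //; apply: HuffmanMerge ht => //.
by rewrite all_map; apply/allP=> y ys /=; rewrite (allP aS) ?(allP xs).
Qed.

(** The first merge is treated apart, since it joins two leaves; from then on there is an internal
    tree, of weight [p + q], that absorbs [s]. *)
Lemma elongated_huffman_tree p q s t : sorted leq [:: p, q & s] ->
    huffman_tree [:: p, q & s] t -> elongated t ->
  absorbs p (q :: s) /\ ext_path_length t = absorb_cost p (q :: s).
Proof.
move=> srt; rewrite /huffman_tree; move fE: (map Leaf _) => f ht et.
case: ht fE et => {f t} [t //|f r t1 t2 t ff min12 hr] fE et.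
have /andP[/= _ cr] := elongated_forest hr et.
have rl : all is_leaf r.
  by move: cr; rewrite all_count; have := count_predC is_leaf r; lia.
have : perm_eq [:: weight t1, weight t2 & map weight r] [:: p, q & s].
  by have := perm_map weight ff; rewrite -fE -map_comp map_id perm_sym.
case/(perm_sorted_head2 srt); first by rewrite all_map.
move=> wE rs.
have [//|||absb tE] := huffman_absorb hr et (a := Node t1 t2) (s := s).
- exact: path_sorted (path_sorted srt).
- by rewrite (all_leaf_map rl) perm_cons perm_map.
have /andP[l1 l2] : is_leaf t1 && is_leaf t2.
  have : all is_leaf f by rewrite -fE all_map; apply/allP.
  by rewrite (perm_all _ ff) /= andbA => /andP[].
have leaf0 v : is_leaf v -> ext_path_length v = 0 by case: v.
rewrite absorbs_cons ?(path_sorted srt) // absorb_cost_cons tE.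
rewrite ext_path_length_node !leaf0 // wE !addn0.
move: absb; rewrite /= wE => absb.
by split=> //; split=> //; have /= /andP[] := order_path_min leq_trans srt.
Qed.

Lemma elongated_huffman_tree_exists p q s : sorted leq [:: p, q & s] ->
    absorbs p (q :: s) ->
  exists2 t, huffman_tree [:: p, q & s] t & elongated t.
Proof.
move=> srt /(absorbs_cons _ (path_sorted srt))[ps pqs].
have ssrt := path_sorted srt.
have [] := @huffman_absorb_exists (Node (Leaf p) (Leaf q)) s => //.
  exact: path_sorted ssrt.
move=> t ht et; exists t => //.
apply: HuffmanMerge ht => //; rewrite all_map.
apply/allP=> x xs /=; rewrite (allP ps) //=.
exact: (allP (order_path_min leq_trans ssrt)).
Qed.

End Trees.

(** * The recurrence satisfied by the minimal sequence *)

Section MinimalSequence.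
Variable R : archiRcfType.
Implicit Types (n k i j m : nat).

Local Notation entry k i := (Pmin_entry R k i.+1).
Local Notation wyt k := (wythoff R (fib k.+2)).

Lemma entry_fib k i : 0 < i <= k.+2 -> entry k i = fib i.
Proof.
case: i => // i /= ik; rewrite /Pmin_entry -[_ == 1]/false addn2 subSS subn0.
case: (leqP i.+2 k.+2) => // ki.
(* At this boundary index the entry is column 0 of the Wythoff row, which is again F(k+2). *)
have -> : i = k.+1 by lia.
by have -> : k.+3 - k - 3 = 0 by lia.
Qed.

Lemma entry_wythoff k j : entry k (k.+2 + j) = wyt k j.
Proof.
rewrite /Pmin_entry -[_ == 1]/false addn2.
have -> : (k.+2 + j).+1 <= k.+2 = false by lia.
by congr (wythoff _ _ _); lia.
Qed.

Lemma wyt1 k : wyt k 1 = (fib k.+3).+1.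
Proof. exact: truncn_fib_golden. Qed.

Lemma wytSS k j : wyt k j.+2 = wyt k j.+1 + wyt k j.
Proof. by []. Qed.

Lemma wyt_ltS k j : 0 < wyt k j < wyt k j.+1.
Proof.
elim: j => [|j /andP[h1 h2]].
  rewrite wyt1 [wyt k 0]/(fib k.+2) (fib_gt0 k.+1) (fibSS k.+1).
  by rewrite ltnS leq_addr.
by rewrite (wytSS k j); lia.
Qed.

(** The extra leading 1 cancels the -1 in F(1) + ... + F(m) = F(m+2) - 1. *)
Lemma sum_entry_fib k m : m <= k.+2 ->
  \sum_(j < m.+1) entry k j = fib m.+2.
Proof.
elim: m => [|m IHm] mk; first by rewrite big_ord1.
by rewrite big_ord_recr IHm ?(ltnW mk) // entry_fib.
Qed.

(** The floor formula gives the excess of one over F(k+3) at the start; the row recurrence then adds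
    the same entry to both sides. *)
Lemma sum_entry_wythoff k j :
  (\sum_(i < k.+2 + j) entry k i).+1 = wyt k j.+1.
Proof.
elim: j => [|j IHj]; first by rewrite addn0 sum_entry_fib ?wyt1.
by rewrite addnS big_ord_recr entry_wythoff (wytSS k j) -IHj addSn.
Qed.

(** The prefix sum attains the maximum in both ranges: it is F(i+2) for [i <= k], and one less than
    the next Wythoff entry for [i > k]. *)
Lemma entryE k i : entry k i.+2 =
  maxn (\sum_(j < i.+1) entry k j) (entry k i.+1) + (k < i).
Proof.
case: leqP => ik.
  rewrite sum_entry_fib ?entry_fib ?addn0; try lia.
  by apply/esym/maxn_idPl; rewrite (fibSS i) leq_addr.
have -> : i = k.+1 + (i - k.+1) by lia.
move: (i - _) => j; have -> : (k.+1 + j).+1 = k.+2 + j by [].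
rewrite entry_wythoff; have -> : (k.+2 + j).+1 = k.+2 + j.+1 by lia.
rewrite entry_wythoff -sum_entry_wythoff addn1; congr _.+1.
have := wyt_ltS k j; rewrite -sum_entry_wythoff ltnS => /andP[_ h].
by apply/esym/maxn_idPl.
Qed.

Lemma size_Pmin n k : size (Pmin R n k) = n.
Proof. by rewrite size_map size_iota. Qed.

Lemma nth_Pmin n k i : i < n -> nth 0 (Pmin R n k) i = entry k i.
Proof. by move=> lt_in; rewrite (nth_map 0) ?size_iota // nth_iota. Qed.

Lemma nth_Pmin_rec n k i : i.+2 < n -> nth 0 (Pmin R n k) i.+2 =
  maxn (prefix_sum (Pmin R n k) i.+1) (nth 0 (Pmin R n k) i.+1) + (k < i).
Proof.
move=> lt_in; rewrite !nth_Pmin ?(ltnW lt_in) // entryE.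
congr (maxn _ _ + _); apply: eq_bigr => j _; rewrite nth_Pmin //.
by have := ltn_ord j; lia.
Qed.

End MinimalSequence.

(** * Membership in the class and minimality *)

(** The maximum is the second entry after [i] merges and the right side the third; strictness
    between integers gains one. *)
Lemma elongated_k_ordered_rec n k (Q : seq nat) i :
    elongated_k_ordered n k Q -> i.+2 < n ->
  maxn (prefix_sum Q i.+1) (nth 0 Q i.+1) + (k < i) <= nth 0 Q i.+2.
Proof.
move=> [[szQ srt _ hle hlt] [t ht et]] lt_in.
case: Q => [|p [|q s]] in szQ srt hle hlt ht *; rewrite /= in szQ; try lia.
have [absb _] := elongated_huffman_tree srt ht et.
have [|n1 n2] := nth_iter_huffman_step (i := i) srt absb.
  by rewrite /=; lia.
case: (leqP i k) => ik; first by have := hle i ik; rewrite n1 n2 addn0 => ->.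
by have := hlt i; rewrite n1 n2 ik addn1; apply; lia.
Qed.

(** Equality in the recurrence makes every merge legal and the gap between second and third entry
    exactly [(k < i)]. *)
Lemma k_ordered_rec_elongated n k (P : seq nat) :
    2 < n -> k <= n - 3 -> size P = n -> nth 0 P 0 = 1 -> nth 0 P 1 = 1 ->
    (forall i, i.+2 < n -> nth 0 P i.+2 =
      maxn (prefix_sum P i.+1) (nth 0 P i.+1) + (k < i)) ->
  elongated_k_ordered n k P.
Proof.
move=> n2 kn szP P0 P1 Prec.
have srt : sorted leq P.
  apply/(sortedP 0) => -[_|i]; first by rewrite P0 P1.
  by rewrite szP => /Prec ->; apply: leq_trans (leq_maxr _ _) (leq_addr _ _).
case: P => [|p [|q s]] in szP P0 P1 Prec srt *; rewrite /= in szP; try lia.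
have absb : absorbs p (q :: s).
  move=> i hi; rewrite -prefix_sum_cons -[nth _ _ _]/(nth 0 [:: p, q & s] i.+2).
  rewrite Prec; last by move: hi; rewrite /=; lia.
  exact: leq_trans (leq_maxl _ _) (leq_addr _ _).
split; last exact: elongated_huffman_tree_exists.
split=> // [|i ik|i /andP[ki i_n]].
- have /= -> := P0; have := order_path_min leq_trans srt.
  by have /= -> := P0.
- have [|-> ->] := nth_iter_huffman_step (i := i) srt absb.
    by rewrite /=; lia.
  by rewrite Prec ?ltnNge ?ik ?addn0 //; lia.
have [|-> ->] := nth_iter_huffman_step (i := i) srt absb.
  by rewrite /=; lia.
by rewrite Prec ?ki ?addn1 //; lia.
Qed.

Theorem theorem2 (R : archiRcfType) (n k : nat)
    (hn : 3 <= n) (hk : k <= n - 3) :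
  minimizing_elongated (elongated_k_ordered n k) (Pmin R n k).
Proof.
have P0 : nth 0 (Pmin R n k) 0 = 1 by rewrite nth_Pmin //; lia.
have P1 : nth 0 (Pmin R n k) 1 = 1 by rewrite nth_Pmin ?entry_fib //; lia.
have szP := size_Pmin R n k.
have MP : elongated_k_ordered n k (Pmin R n k).
  by apply: k_ordered_rec_elongated => // i; apply: nth_Pmin_rec.
split=> // Q t u MQ ht et hu eu.
have PQ i : i < n -> nth 0 (Pmin R n k) i <= nth 0 Q i.
  have [[szQ _ posQ _ _] _] := MQ.
  elim/ltn_ind: i => -[|[|i]] IHi lt_in.
  - by rewrite P0 (all_nthP 0 posQ) ?szQ.
  - by rewrite P1 (all_nthP 0 posQ) ?szQ.
  (* The recurrence is monotone in the earlier entries, and [Q] satisfies it as an inequality. *)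
  rewrite nth_Pmin_rec //; apply: leq_trans (elongated_k_ordered_rec MQ lt_in).
  rewrite leq_add2r geq_max !leq_max IHi ?orbT ?(ltnW lt_in) // andbT.
  apply/orP; left; apply: leq_sum => j _; apply: IHi; have := ltn_ord j; lia.
have [[szQ srtQ _ _ _] _] := MQ; have [[_ srtP _ _ _] _] := MP => {MQ}.
move: (Pmin R n k) szP srtP PQ ht => P szP srtP PQ ht.
case: P => [|p [|q s]] in szP srtP PQ ht *; rewrite /= in szP; try lia.
case: Q => [|p' [|q' s']] in szQ srtQ PQ hu *; rewrite /= in szQ; try lia.
have [_ ->] := elongated_huffman_tree srtP ht et.
have [_ ->] := elongated_huffman_tree srtQ hu eu.
(* Both costs are sums of equally many prefix sums, so the entrywise comparison suffices. *)
rewrite /absorb_cost /=; have -> : size s' = size s by lia.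
apply: leq_sum => i _; rewrite -!prefix_sum_cons.
by apply: leq_sum => j _; apply: PQ; have := ltn_ord i; have := ltn_ord j; lia.
Qed.
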